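(* Let $M$ be a $G$-graded $R$-module. If $\rho$ is surjective, then for each $r\in h(R)$ the open set $S_r=\mathcal{PS}_G(M)-\nu_G(rM)$ in $\mathcal{PS}_G(M)$ is quasi-compact; in particular, the space $\mathcal{PS}_G(M)$ is quasi-compact.
   Context: $G$ is a multiplicative group, $R=\bigoplus_{g\in G}R_g$ is a commutative $G$-graded ring with identity ($R_gR_h\subseteq R_{gh}$), and $M=\bigoplus_{g\in G}M_g$ is a $G$-graded $R$-module ($R_gM_h\subseteq M_{gh}$). $h(R)=\bigcup_g R_g$ and $h(M)=\bigcup_g M_g$ are the sets of homogeneous elements. An ideal $I$ is graded if $I=\bigoplus_g(I\cap R_g)$; a submodule $N$ is graded if $N=\bigoplus_g(N\cap M_g)$. For a graded submodule $N$, $(N:_R M)=\{r\in R: rM\subseteq N\}$, a graded ideal of $R$. For a graded ideal $I$, the graded radical $Gr(I)$ is the set of all $a=\sum_g a_g\in R$ such that for each $g$ there is $n_g>0$ with $a_g^{n_g}\in I$. For a graded ring $A$, a graded prime ideal is a proper graded ideal $p$ such that $ab\in p$ with $a,b\in h(A)$ implies $a\in p$ or $b\in p$; $Spec_G(A)$ is the set of these. A proper graded submodule $P$ of $M$ is graded prime if for $r\in h(R)$, $m\in h(M)$, $rm\in P$ implies $m\in P$ or $r\in(P:_R M)$. $Spec_G(M)$ is the set of graded prime submodules of $M$. A proper graded submodule $Q$ is graded primary if for $r\in h(R)$, $m\in h(M)$, $rm\in Q$ implies $m\in Q$ or $r\in Gr((Q:_R M))$. For a graded submodule $N$, $Gr_M(N)$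 is the intersection of all graded prime submodules of $M$ containing $N$, with $Gr_M(N)=M$ if there are none. The graded primary spectrum $\mathcal{PS}_G(M)$ is the set of all graded primary submodules $Q$ of $M$ with $(Gr_M(Q):_R M)=Gr((Q:_R M))$; for such $Q$, $(Gr_M(Q):_R M)\in Spec_G(R)$. For a graded submodule $N$ of $M$, $\nu_G(N)=\{Q\in\mathcal{PS}_G(M): (N:_R M)\subseteq(Gr_M(Q):_R M)\}$. $\mathcal{PS}_G(M)$ carries the Zariski topology, whose closed sets are exactly the sets $\nu_G(N)$, $N$ a graded submodule of $M$. Write $\overline{R}=R/Ann(M)$ with the induced grading. The map $\rho:\mathcal{PS}_G(M)\to Spec_G(\overline{R})$ is $\rho(Q)=(Gr_M(Q):_R M)/Ann(M)$. Standing assumption: $Spec_G(M)$ and $\mathcal{PS}_G(M)$ are non-empty. *)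

(* Defs.v *)
From HB Require Import structures.
From mathcomp Require Import all_boot all_algebra finmap.
From mathcomp Require Import boolp classical_sets functions cardinality fsbigop.
From mathcomp Require Import topology.

Set Implicit Arguments.
Unset Strict Implicit.
Unset Printing Implicit Defensive.

Import GRing.Theory.

Local Open Scope classical_set_scope.
Local Open Scope ring_scope.

Section DirectSum.
Variables (G : choiceType) (V : zmodType).
Implicit Types (A N : set V) (c : G -> V).

Definition additive_subgroup A : Prop :=
  A 0 /\ forall x y, A x -> A y -> A (x - y).

(* The sum over all of G is 0 by convention when its support is infinite, so
   finiteness of the support has to be required separately. *)
Definition decomposition (V_ : G -> set V) (x : V) c : Prop :=
  [/\ forall g, V_ g (c g),
      finite_set [set g | c g != 0]
    & x = \sum_(g \in [set: G]) c g].

Definition internal_direct_sum (V_ : G -> set V) N : Prop :=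
  [/\ forall g, additive_subgroup (V_ g),
      forall x, N x <-> exists c, decomposition V_ x c
    & forall x c c', decomposition V_ x c -> decomposition V_ x c' -> c = c'].

Definition homogeneous (V_ : G -> set V) : set V := \bigcup_(g in [set: G]) V_ g.

End DirectSum.

Section DirectSumFacts.
Variables (G : choiceType) (V : zmodType).
Implicit Types (A N : set V) (c : G -> V).

Lemma decompP (V_ : G -> set V) x c : decomposition V_ x c <->
  (forall g, V_ g (c g)) /\
  exists s : {fset G}, (forall g, g \notin s -> c g = 0) /\ x = \sum_(g <- s) c g.
Proof.
split=> [[Vc fc ->]|[Vc [s [sc ->]]]].
- split=> //; exists (fset_set [set g | c g != 0]).
  have sc g : g \notin fset_set [set g | c g != 0] -> c g = 0.
    by rewrite in_fset_set// notin_setE/= => /negP/negPn/eqP.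
  by split=> //; rewrite (fsbigTE _ _ sc).
- split=> //; last by rewrite (fsbigTE _ _ sc).
  apply: (finite_subfset s) => g /=; apply: contra_neqT; exact: sc.
Qed.

Lemma subgroupN A x : additive_subgroup A -> A x -> A (- x).
Proof. by move=> [A0 AB] Ax; rewrite -sub0r; apply: AB. Qed.

Lemma subgroupD A x y : additive_subgroup A -> A x -> A y -> A (x + y).
Proof.
move=> sA Ax Ay; rewrite -[y]opprK; apply: sA.2 => //.
exact: subgroupN.
Qed.

Lemma subgroup_sum A (I : Type) (s : seq I) (c : I -> V) :
  additive_subgroup A -> (forall g, A (c g)) -> A (\sum_(g <- s) c g).
Proof.
move=> sA Ac; elim/big_ind: _ => [|x y|//]; first exact: sA.1.
exact: subgroupD.
Qed.

Lemma subgroup_decomp (V_ : G -> set V) A x c : additive_subgroup A ->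
  (forall g, A (c g)) -> decomposition V_ x c -> A x.
Proof. by move=> sA Ac /decompP[_ [s [_ ->]]]; apply: subgroup_sum. Qed.

Lemma decompB (V_ : G -> set V) x c x' c' : (forall g, additive_subgroup (V_ g)) ->
  decomposition V_ x c -> decomposition V_ x' c' ->
  decomposition V_ (x - x') (fun g => c g - c' g).
Proof.
move=> sV /decompP[Vc [s [sc ->]]] /decompP[Vc' [s' [sc' ->]]].
apply/decompP; split=> [g|]; first exact: (sV g).2.
exists (s `|` s')%fset; split=> [g|].
  by rewrite in_fsetU negb_or => /andP[/sc-> /sc'->]; rewrite subr0.
rewrite sumrB; congr (_ - _).
- by rewrite -(fsbigTE s)// (fsbigTE (s `|` s')%fset)// => g;
    rewrite in_fsetU negb_or => /andP[/sc-> _].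
- by rewrite -(fsbigTE s')// (fsbigTE (s `|` s')%fset)// => g;
    rewrite in_fsetU negb_or => /andP[_ /sc'->].
Qed.

Lemma decomp0 (V_ : G -> set V) : (forall g, additive_subgroup (V_ g)) ->
  decomposition V_ 0 (fun=> 0).
Proof.
move=> sV; apply/decompP; split=> [g|]; first exact: (sV g).1.
by exists fset0; split=> //; rewrite big_seq_fset0.
Qed.

Lemma decomp_sub (V_ W_ : G -> set V) x c : (forall g, W_ g (c g)) ->
  decomposition V_ x c -> decomposition W_ x c.
Proof. by move=> Wc []. Qed.

Lemma decomp_reindex (V_ W_ : G -> set V) x c (h h' : G -> G) :
  cancel h h' -> cancel h' h -> (forall g, W_ g (c (h g))) ->
  decomposition V_ x c -> decomposition W_ x (c \o h).
Proof.
move=> hK h'K Wc [_ fc ->]; split=> //.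
  apply: (@sub_finite_set _ _ (h' @` [set g | c g != 0])).
    by move=> g /= cg; exists (h g).
  exact: finite_image.
by apply: reindex_fsbigT; exists h'.
Qed.

Lemma direct_sum0 (V_ : G -> set V) N : (forall g, additive_subgroup (V_ g)) ->
  (forall x, N x <-> exists c, decomposition V_ x c) ->
  (forall c, decomposition V_ 0 c -> forall g, c g = 0) ->
  internal_direct_sum V_ N.
Proof.
move=> sV NE V0; split=> // x c c' dc dc'; apply/funext => g.
apply/eqP; rewrite -subr_eq0; apply/eqP.
by apply: (V0 (fun g => c g - c' g)); rewrite -(subrr x); apply: decompB.
Qed.

Lemma direct_sum_subP (V_ : G -> set V) N : internal_direct_sum V_ setT ->
  additive_subgroup N ->
  internal_direct_sum (fun g => N `&` V_ g) N <->
  (forall x c, N x -> decomposition V_ x c -> forall g, N (c g)).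
Proof.
move=> [sV VE Vu] sN; split=> [[_ NE _] x c Nx dc g|H].
  have /NE[c' dc'] := Nx.
  have Nc' := dc' ; case: Nc' => Nc' _ _.
  rewrite (Vu _ _ _ dc (decomp_sub (fun g => (Nc' g).2) dc')).
  exact: (Nc' g).1.
have sNV g : additive_subgroup (N `&` V_ g).
  split; first by split; [exact: sN.1|exact: (sV g).1].
  by move=> x y [? ?] [? ?]; split; [exact: sN.2|exact: (sV g).2].
split=> // [x|x c c' dc dc'].
  split=> [Nx|[c dc]].
    have /VE[c dc] : [set: V] x by [].
    have [Vc _ _] := dc.
    by exists c; apply: (decomp_sub _ dc) => g; split; [exact: (H x)|].
  have [Vc _ _] := dc.
  by apply: (subgroup_decomp sN _ dc) => g; case: (Vc g).
have [Vc _ _] := dc; have [Vc' _ _] := dc'.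
by apply: (Vu x); [apply: decomp_sub dc|apply: decomp_sub dc'] => g;
  [case: (Vc g)|case: (Vc' g)].
Qed.

Lemma decomp_hom (V_ : G -> set V) g x : (forall g, additive_subgroup (V_ g)) -> V_ g x ->
  decomposition V_ x (fun h => if h == g then x else 0).
Proof.
move=> sV Vx; apply/decompP; split=> [h|].
  by case: eqP => [->//|_]; exact: (sV h).1.
exists [fset g]%fset; split=> [h|]; first by rewrite in_fset1 => /negPf->.
by rewrite big_seq_fset1 eqxx.
Qed.

Lemma decomp_homogeneous (V_ : G -> set V) x c g : decomposition V_ x c -> homogeneous V_ (c g).
Proof. by case=> Vc _ _; exists g. Qed.

End DirectSumFacts.

Lemma decomp_morph (G : choiceType) (V W : zmodType) (V_ : G -> set V) (W_ : G -> set W) (f : V -> W) x (c : G -> V) :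
  f 0 = 0 -> {morph f : a b / a + b} -> (forall g, W_ g (f (c g))) ->
  decomposition V_ x c -> decomposition W_ (f x) (f \o c).
Proof.
move=> f0 fD Wfc /decompP[Vc [s [sc ->]]]; apply/decompP; split=> //.
exists s; split=> [g /sc /= ->//|].
by rewrite (big_morph f fD f0).
Qed.

Record gradedRing (G : groupType) (R : comPzRingType) := GradedRing {
  ring_component :> G -> set R;
  ring_componentP : internal_direct_sum ring_component [set: R];
  ring_componentM : forall g h r s,
    ring_component g r -> ring_component h s -> ring_component (g * h)%g (r * s)
}.

Record gradedModule (G : groupType) (R : comPzRingType) (gR : gradedRing G R)
    (M : lmodType R) := GradedModule {
  module_component :> G -> set M;
  module_componentP : internal_direct_sum module_component [set: M];
  module_componentZ : forall g h r m,
    gR g r -> module_component h m -> module_component (g * h)%g (r *: m)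
}.

Section GradedRing.
Variables (G : groupType) (R : comPzRingType) (gR : gradedRing G R).
Implicit Types I p : set R.

Definition ideal I : Prop :=
  I 0 /\ forall a x y, I x -> I y -> I (a * x + y).

Definition graded_ideal I : Prop :=
  ideal I /\ internal_direct_sum (fun g => I `&` gR g) I.

(* Components are unique by ring_componentP, so the choice of c is immaterial. *)
Definition graded_radical I : set R :=
  [set a | exists c, decomposition gR a c /\
    forall g, exists n : nat, (0 < n)%N /\ I (c g ^+ n)].

Definition graded_prime_ideal p : Prop :=
  [/\ graded_ideal p, p <> [set: R]
    & forall a b, homogeneous gR a -> homogeneous gR b ->
        p (a * b) -> p a \/ p b].

Definition Spec_ring : set (set R) := [set p | graded_prime_ideal p].

End GradedRing.

Section GradedModule.
Variables (G : groupType) (R : comPzRingType) (gR : gradedRing G R).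
Variables (M : lmodType R) (gM : gradedModule gR M).
Implicit Types N P Q : set M.

Definition submodule N : Prop :=
  N 0 /\ forall a x y, N x -> N y -> N (a *: x + y).

Definition graded_submodule N : Prop :=
  submodule N /\ internal_direct_sum (fun g => N `&` gM g) N.

Definition colon N : set R := [set r | forall m : M, N (r *: m)].

Definition graded_prime P : Prop :=
  [/\ graded_submodule P, P <> [set: M]
    & forall r m, homogeneous gR r -> homogeneous gM m ->
        P (r *: m) -> P m \/ colon P r].

Definition Spec_module : set (set M) := [set P | graded_prime P].

Definition graded_primary Q : Prop :=
  [/\ graded_submodule Q, Q <> [set: M]
    & forall r m, homogeneous gR r -> homogeneous gM m ->
        Q (r *: m) -> Q m \/ graded_radical gR (colon Q) r].

(* An intersection over an empty family is the whole of M, as required when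
   no graded prime submodule contains N. *)
Definition module_radical N : set M :=
  \bigcap_(P in [set P | Spec_module P /\ N `<=` P]) P.

Definition primary_spectrum_set : set (set M) :=
  [set Q | graded_primary Q /\
    colon (module_radical Q) = graded_radical gR (colon Q)].

(* An alias, so that the Zariski topology below does not compete with the
   initial topology that the library puts on set_type. *)
Definition primary_spectrum : Type := set_type primary_spectrum_set.
HB.instance Definition _ := Choice.on primary_spectrum.

Definition submodule_of_point (Q : primary_spectrum) : set M := val Q.
Coercion submodule_of_point : primary_spectrum >-> set.

Definition nu N : set primary_spectrum :=
  [set Q | colon N `<=` colon (module_radical Q)].

End GradedModule.
Arguments nu {G R gR M} gM N _.

Definition basic_open (G : groupType) (R : comPzRingType) (gR : gradedRing G R)
    (M : lmodType R) (gM : gradedModule gR M) (r : R) :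
    set (primary_spectrum gM) :=
  ~` nu gM [set r *: m | m in [set: M]].
Arguments basic_open {G R gR M} gM r _.

Section GradedFacts.
Variables (G : groupType) (R : comPzRingType) (gR : gradedRing G R).
Variables (M : lmodType R) (gM : gradedModule gR M).
Implicit Types (N P Q : set M) (I J p : set R).

Lemma ideal_subgroup I : ideal I -> additive_subgroup I.
Proof.
move=> [I0 IP]; split=> // x y Ix Iy.
by rewrite addrC -mulN1r; apply: IP.
Qed.

Lemma ideal_mul I a x : ideal I -> I x -> I (a * x).
Proof. by move=> [I0 IP] Ix; rewrite -[a * x]addr0; apply: IP. Qed.

Lemma submodule_subgroup N : submodule N -> additive_subgroup N.
Proof.
move=> [N0 NP]; split=> // x y Nx Ny.
by rewrite addrC -scaleN1r; apply: NP.
Qed.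

Lemma submoduleZ N a x : submodule N -> N x -> N (a *: x).
Proof. by move=> [N0 NP] Nx; rewrite -[a *: x]addr0; apply: NP. Qed.

Lemma gradedI I x c : graded_ideal gR I -> I x -> decomposition gR x c ->
  forall g, I (c g).
Proof.
move=> [/ideal_subgroup sI /(direct_sum_subP (ring_componentP gR) sI)].
by move=> H; apply: H.
Qed.

Lemma gradedN N x c : graded_submodule gM N -> N x -> decomposition gM x c ->
  forall g, N (c g).
Proof.
move=> [/submodule_subgroup sN /(direct_sum_subP (module_componentP gM) sN)].
by move=> H; apply: H.
Qed.

Lemma ring_decomp x : exists c, decomposition gR x c.
Proof. by case: (ring_componentP gR) => _ /(_ x)[H _] _; apply: H. Qed.

Lemma module_decomp x : exists c, decomposition gM x c.
Proof. by case: (module_componentP gM) => _ /(_ x)[H _] _; apply: H. Qed.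

Lemma ring_component_subgroup g : additive_subgroup (gR g).
Proof. by case: (ring_componentP gR). Qed.

Lemma module_component_subgroup g : additive_subgroup (gM g).
Proof. by case: (module_componentP gM). Qed.

Lemma ring_decomp_uniq x c c' : decomposition gR x c -> decomposition gR x c' ->
  c = c'.
Proof. by case: (ring_componentP gR) => _ _; apply. Qed.

Lemma colon_ideal N : submodule N -> ideal (colon N).
Proof.
move=> [N0 NP]; split=> [m|a x y Nx Ny m]; first by rewrite scale0r.
by rewrite scalerDl -scalerA; apply: NP.
Qed.

Lemma colon_graded N : graded_submodule gM N -> graded_ideal gR (colon N).
Proof.
move=> gN; have sN := gN.1; split; first exact: colon_ideal.
apply/(direct_sum_subP (ring_componentP gR)) => [|r c Nr dc g m].
  exact/ideal_subgroup/colon_ideal.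
have Nhom h n : gM h n -> N (c g *: n).
  move=> Mn; have df : decomposition gM (r *: n) (fun k => c (k * h^-1)%g *: n).
    apply: (decomp_reindex (V_ := fun g => gM (g * h)%g) (x := r *: n)
      (c := fun g => c g *: n) (h := fun k => (k * h^-1)%g) (h' := fun k => (k * h)%g)).
    - by move=> k; rewrite mulgVK.
    - by move=> k; rewrite mulgK.
    - move=> k; have [Rc _ _] := dc.
      by rewrite -[k in gM k](mulgVK h); apply: module_componentZ.
    - apply: (decomp_morph (f := fun a => a *: n) _ _ _ dc).
      + by rewrite scale0r.
      + by move=> a b; rewrite scalerDl.
      + by move=> k; have [Rc _ _] := dc; apply: module_componentZ.
  by have := gradedN gN (Nr n) df (g * h)%g; rewrite /= mulgK.
have [d dd] := module_decomp m.
apply: (subgroup_decomp (submodule_subgroup sN) (V_ := fun=> setT)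
  (c := fun h => c g *: d h)).
  by move=> h; apply: (Nhom h); case: dd.
apply: (decomp_morph (f := fun a => c g *: a) _ _ _ dd) => //.
- by rewrite scaler0.
- by move=> a b; rewrite scalerDr.
Qed.

Lemma graded_submodule_bigcap (F : set (set M)) :
  (forall N, F N -> graded_submodule gM N) ->
  graded_submodule gM (\bigcap_(N in F) N).
Proof.
move=> FN.
have sF : submodule (\bigcap_(N in F) N).
  split=> [N /FN[[]]//|a x y Fx Fy N FNN].
  by have [[_ NP] _] := FN _ FNN; apply: NP; [apply: Fx|apply: Fy].
split=> //; apply/(direct_sum_subP (module_componentP gM)).
  exact: submodule_subgroup.
move=> x c Fx dc g N FNN; apply: gradedN dc g; first exact: FN.
exact: Fx.
Qed.

Lemma graded_submoduleT : graded_submodule gM setT.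
Proof.
split=> //; apply/(direct_sum_subP (module_componentP gM)) => //.
Qed.

Lemma module_radical_graded N : graded_submodule gM (module_radical gM N).
Proof. by apply: graded_submodule_bigcap => P [[]]. Qed.

Lemma colonS N P : N `<=` P -> colon N `<=` colon P.
Proof. by move=> NP r Nr m; apply: NP. Qed.

Lemma colonI N P : colon (N `&` P) = colon N `&` colon P.
Proof.
apply/seteqP; split=> r; first by move=> H; split=> m; have [] := H m.
by move=> [Nr Pr] m; split.
Qed.

Lemma graded_scale r : homogeneous gR r ->
  graded_submodule gM [set r *: m | m in [set: M]].
Proof.
move=> [g _ Rr].
have sN : submodule [set r *: m | m in [set: M]].
  split=> [|a _ _ [m _ <-] [n _ <-]]; first by exists 0; rewrite ?scaler0.
  by exists (a *: m + n) => //; rewrite scalerDr !scalerA mulrC.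
split=> //; apply/(direct_sum_subP (module_componentP gM)).
  exact: submodule_subgroup.
move=> _ c [m _ <-] dc k; have [d dd] := module_decomp m; have [Md _ _] := dd.
have df : decomposition gM (r *: m) (fun k => r *: d (g^-1 * k)%g).
  apply: (decomp_reindex (V_ := fun h => gM (g * h)%g) (x := r *: m)
    (c := fun h => r *: d h) (h := fun k => (g^-1 * k)%g) (h' := fun k => (g * k)%g)).
  - by move=> h; rewrite mulVKg.
  - by move=> h; rewrite mulKg.
  - move=> h; rewrite -[h in gM h](mulVKg g).
    exact: module_componentZ.
  - apply: (decomp_morph (f := fun a => r *: a) _ _ _ dd).
    + by rewrite scaler0.
    + by move=> a b; rewrite scalerDr.
    + by move=> h; apply: module_componentZ.
have [_ _ u] := module_componentP gM.
by rewrite (u _ _ _ dc df); exists (d (g^-1 * k)%g).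
Qed.

Lemma hom_radical I g a : ideal I -> gR g a ->
  graded_radical gR I a <-> exists n : nat, (0 < n)%N /\ I (a ^+ n).
Proof.
move=> iI Ra.
have dh := decomp_hom ring_component_subgroup Ra.
split=> [[c [dc Hc]]|[n [n0 In]]].
  by have := Hc g; rewrite (ring_decomp_uniq dc dh) eqxx.
exists (fun h => if h == g then a else 0); split=> // h.
case: eqP => _; first by exists n.
by exists 1%N; split=> //; rewrite expr1; case: iI.
Qed.

Lemma homogeneousM a b : homogeneous gR a -> homogeneous gR b ->
  homogeneous gR (a * b).
Proof.
by move=> [g _ Ra] [h _ Rb]; exists (g * h)%g => //; apply: ring_componentM.
Qed.

Lemma homogeneousXS a n : homogeneous gR a -> homogeneous gR (a ^+ n.+1).
Proof.
move=> Ra; elim: n => [|n IHn]; first by rewrite expr1.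
by rewrite exprS; apply: homogeneousM.
Qed.

Lemma homogeneousZ a m : homogeneous gR a -> homogeneous gM m ->
  homogeneous gM (a *: m).
Proof.
by move=> [g _ Ra] [h _ Rb]; exists (g * h)%g => //; apply: module_componentZ.
Qed.

Lemma radicalT I : ideal I -> graded_radical gR I 1 -> I 1.
Proof.
move=> iI [c [dc Hc]].
suff [n In] : exists n, I (1 ^+ n) by rewrite expr1n in In.
have [_ [s [_ {1}->]]] := (decompP _ _ _).1 dc.
elim/big_ind: _ => [|x y [n In] [m Im]|g _].
- by exists 1%N; rewrite expr1; case: iI.
- exists (n + m)%N; rewrite exprDn.
  apply: subgroup_sum; first exact: ideal_subgroup.
  move=> i; rewrite -mulr_natr mulrC; apply: ideal_mul => //.
  have [le_mi|lt_im] := leqP m i.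
    rewrite -(subnK le_mi) exprD mulrA; exact: ideal_mul.
  have le_n : (n <= n + m - i)%N.
    by rewrite -addnBA ?leq_addr// ltnW.
  rewrite -(subnK le_n) exprD mulrC mulrA; exact: ideal_mul.
- by have [n [_ In]] := Hc g; exists n.
Qed.

Lemma point_prime (Q : primary_spectrum gM) :
  graded_prime_ideal gR (colon (module_radical gM Q)).
Proof.
have [[gQ QT Qp] EQ] : primary_spectrum_set gM Q := set_valP Q.
have iQ := colon_ideal gQ.1.
split.
- exact/colon_graded/module_radical_graded.
- rewrite EQ => eT; apply: QT; apply/seteqP; split=> // m _.
  have Q1 : colon Q 1 by apply: radicalT; rewrite // eT.
  by rewrite -[m]scale1r; apply: Q1.
move=> a b ha hb; rewrite !EQ.
have [[g _ Ra] [h _ Rb]] := (ha, hb).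
have [k _ Rab] := homogeneousM ha hb.
move=> /(hom_radical iQ Rab)[[|n] [] // _ In].
have [Qb|nQb] := pselect (colon Q (b ^+ n.+1)).
  by right; apply/(hom_radical iQ Rb); exists n.+1.
left; have [m [mh Hm]] : exists m, homogeneous gM m /\ ~ (Q : set M) (b ^+ n.+1 *: m).
  apply: contrapT => Hm; apply: nQb => m.
  have [d dd] := module_decomp m.
  apply: (subgroup_decomp (submodule_subgroup gQ.1) (V_ := fun=> setT)
    (c := fun h => b ^+ n.+1 *: d h)).
    move=> i; apply: contrapT => Hi; apply: Hm; exists (d i); split=> //.
    exact: decomp_homogeneous dd.
  apply: (decomp_morph (f := fun a => b ^+ n.+1 *: a) _ _ _ dd) => //.
  - by rewrite scaler0.
  - by move=> u v; rewrite scalerDr.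
have han := homogeneousXS n ha.
have hbm : homogeneous gM (b ^+ n.+1 *: m).
  exact: homogeneousZ (homogeneousXS n hb) mh.
have Qabm : (Q : set M) (a ^+ n.+1 *: (b ^+ n.+1 *: m)).
  by rewrite scalerA -exprMn; apply: In.
have [//|] := Qp _ _ han hbm Qabm.
have [i _ Ran] := han.
move=> /(hom_radical iQ Ran)[j [j0 Ij]].
apply/(hom_radical iQ Ra); exists (n.+1 * j)%N.
by rewrite muln_gt0 j0 exprM.
Qed.

Lemma prime_capI p I J : graded_prime_ideal gR p ->
  graded_ideal gR I -> graded_ideal gR J -> I `&` J `<=` p ->
  I `<=` p \/ J `<=` p.
Proof.
move=> [gp _ pp] gI gJ IJp.
have wit K : graded_ideal gR K -> ~ K `<=` p ->
    exists a, [/\ homogeneous gR a, K a & ~ p a].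
  move=> gK nKp; apply: contrapT => H; apply: nKp => x Kx.
  have [c dc] := ring_decomp x.
  apply: (subgroup_decomp _ _ dc); first exact/ideal_subgroup/gp.1.
  move=> g; apply: contrapT => npc; apply: H; exists (c g); split=> //.
    exact: decomp_homogeneous dc.
  by apply: (gradedI gK Kx dc).
have [|nI] := pselect (I `<=` p); first by left.
have [|nJ] := pselect (J `<=` p); first by right.
have [a [ha Ia npa]] := wit _ gI nI.
have [b [hb Jb npb]] := wit _ gJ nJ.
have [|//|//] := pp a b ha hb _.
apply: IJp; split; last exact: ideal_mul gJ.1 Jb.
by rewrite mulrC; apply: ideal_mul gI.1 Ia.
Qed.

Definition zariski_open : set_system (primary_spectrum gM) :=
  [set U | exists N, graded_submodule gM N /\ U = ~` nu gM N].

Lemma zariski_openT : zariski_open setT.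
Proof.
exists setT; split; first exact: graded_submoduleT.
rewrite -setC0; congr (~` _); apply/seteqP; split=> // Q HQ.
by have [_ pT _] := point_prime Q; apply: pT; apply/seteqP; split=> // r _; apply: HQ.
Qed.

Lemma zariski_openI : setI_closed zariski_open.
Proof.
move=> _ _ [N [gN ->]] [P [gP ->]]; exists (N `&` P); split.
  have -> : N `&` P = \bigcap_(L in [set N; P]) L.
    apply/seteqP; split=> m; first by move=> [Nm Pm] L [->|->].
    by move=> H; split; apply: H; [left|right].
  by apply: graded_submodule_bigcap => L [->|->].
rewrite -setCU; congr (~` _); apply/seteqP; split=> Q.
  by rewrite /nu/= colonI => -[] H r [Nr Pr]; apply: H.
rewrite /nu/= colonI => H.
have [] := prime_capI (point_prime Q) (colon_graded gN) (colon_graded gP) H.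
  by left.
by right.
Qed.

Lemma zariski_open_bigU (I : Type) (f : I -> set (primary_spectrum gM)) :
  (forall i, zariski_open (f i)) -> zariski_open (\bigcup_i f i).
Proof.
move=> /choice[N HN].
pose F := [set L : set M | graded_submodule gM L /\
  forall i, colon (N i) `<=` colon L].
exists (\bigcap_(L in F) L); split.
  by apply: graded_submodule_bigcap => L [].
rewrite (eq_bigcupr (G := fun i => ~` nu gM (N i))); last by move=> i _; case: (HN i).
rewrite -setC_bigcap; congr (~` _); apply/seteqP; split=> Q HQ.
  move=> r Fr m; apply: (Fr m); split; first exact: module_radical_graded.
  by move=> i; apply: HQ.
move=> i _ r Nr; apply: HQ => m L [_ NL]; exact: NL Nr m.
Qed.

End GradedFacts.

Section Zariski.
Variables (G : groupType) (R : comPzRingType) (gR : gradedRing G R).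
Variables (M : lmodType R) (gM : gradedModule gR M).

HB.instance Definition _ := isOpenTopological.Build (primary_spectrum gM)
  (@zariski_openT _ _ _ _ gM) (@zariski_openI _ _ _ _ gM)
  (@zariski_open_bigU _ _ _ _ gM).

Lemma zariski_openP (U : set (primary_spectrum gM)) :
  open U <-> zariski_open U.
Proof.
split=> [|HU]; last first.
  rewrite openE => Q UQ.
  have : nbhs_of_open (@zariski_open _ _ _ _ gM) Q U by exists U; split.
  exact.
rewrite openE => oU.
have -> : U = \bigcup_(V : {V | zariski_open V /\ V `<=` U}) projT1 V.
  apply/seteqP; split=> [Q /oU[V [oV VQ VU]]|Q [[V [oV VU]] _ /= VQ]].
    by exists (exist _ V (conj oV VU)).
  exact: VU.
by apply: zariski_open_bigU => -[V []].
Qed.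

Lemma closed_nuP (A : set (primary_spectrum gM)) :
  closed A <-> exists N, graded_submodule gM N /\ A = nu gM N.
Proof.
rewrite -openC zariski_openP; split=> -[N [gN E]]; exists N; split=> //.
  exact: setC_inj.
by rewrite E.
Qed.

Lemma basic_open_open r : homogeneous gR r -> open (basic_open gM r).
Proof.
move=> hr; apply/zariski_openP; exists [set r *: m | m in [set: M]].
by split=> //; apply: graded_scale.
Qed.

End Zariski.

Section AnnihilatorQuotient.
Variables (R : comPzRingType) (M : lmodType R).

Definition annihilator : {pred R} := fun r => `[< forall m : M, r *: m = 0 >].

Lemma annihilatorP r : reflect (forall m : M, r *: m = 0) (r \in annihilator).
Proof. exact: asboolP. Qed.

Fact annihilator_zmod_closed : zmod_closed annihilator.
Proof.
split=> [|r s /annihilatorP Hr /annihilatorP Hs]; apply/annihilatorP => m.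
  by rewrite scale0r.
by rewrite scalerBl Hr Hs subrr.
Qed.
HB.instance Definition _ :=
  GRing.isZmodClosed.Build R annihilator annihilator_zmod_closed.

Lemma annihilatorM r s : s \in annihilator -> r * s \in annihilator.
Proof.
move=> /annihilatorP Hs; apply/annihilatorP => m.
by rewrite -scalerA Hs scaler0.
Qed.

(* The library only puts a ring structure on the quotient by a proper ideal,
   whereas the annihilator of the zero module is the whole ring; hence only
   the additive quotient is taken from it. *)
Definition annihilator_quotient : Type := Quotient.quot annihilator.
HB.instance Definition _ := GRing.Zmodule.on annihilator_quotient.

Local Open Scope quotient_scope.

Definition annihilator_proj (r : R) : annihilator_quotient :=
  \pi_(Quotient.quot annihilator) r.
Local Notation pi := annihilator_proj.

Lemma projP (x : annihilator_quotient) : exists r, pi r = x.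
Proof. by exists (repr (x : Quotient.quot annihilator)); apply: reprK. Qed.

Lemma proj_eq r s : pi r = pi s <-> r - s \in annihilator.
Proof.
by rewrite Quotient.idealrBE; split=> [/eqP|/eqP].
Qed.

Lemma proj_eq0 r : pi r = 0 <-> r \in annihilator.
Proof.
rewrite -[r in r \in _]subr0 -proj_eq; suff -> : pi 0 = 0 by [].
by rewrite /pi raddf0.
Qed.

Lemma projD : {morph pi : r s / r + s}.
Proof. by move=> r s; rewrite /pi raddfD. Qed.

Lemma proj0 : pi 0 = 0.
Proof. by rewrite /pi raddf0. Qed.

Lemma projB : {morph pi : r s / r - s}.
Proof. by move=> r s; rewrite /pi raddfB. Qed.

Definition annihilator_quotient_mul (x y : annihilator_quotient) :
  annihilator_quotient :=
  pi (repr (x : Quotient.quot annihilator) * repr (y : Quotient.quot annihilator)).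
Local Notation mul := annihilator_quotient_mul.

Fact proj_mul r s : pi (r * s) = mul (pi r) (pi s).
Proof.
rewrite /mul; set r' := repr _; set s' := repr _.
have Hr : r - r' \in annihilator by apply/proj_eq/esym; exact: reprK.
have Hs : s - s' \in annihilator by apply/proj_eq/esym; exact: reprK.
apply/proj_eq.
have -> : r * s - r' * s' = s * (r - r') + r' * (s - s').
  by rewrite !mulrBr [s * r]mulrC [s * r']mulrC addrA subrK.
by apply: rpredD; apply: annihilatorM.
Qed.

Fact quotient_mulA : associative mul.
Proof.
move=> x y z; have [[[a <-] [b <-]] [c <-]] := (projP x, projP y, projP z).
by rewrite -!proj_mul mulrA.
Qed.

Fact quotient_mulC : commutative mul.
Proof.
by move=> x y; have [[a <-] [b <-]] := (projP x, projP y); rewrite -!proj_mul mulrC.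
Qed.

Fact quotient_mul1 : left_id (pi 1) mul.
Proof. by move=> x; have [a <-] := projP x; rewrite -proj_mul mul1r. Qed.

Fact quotient_mulDl : left_distributive mul +%R.
Proof.
move=> x y z; have [[[a <-] [b <-]] [c <-]] := (projP x, projP y, projP z).
by rewrite -projD -!proj_mul mulrDl projD.
Qed.

HB.instance Definition _ := GRing.Zmodule_isComPzRing.Build annihilator_quotient
  quotient_mulA quotient_mulC quotient_mul1 quotient_mulDl.

Lemma projM : {morph pi : r s / r * s}.
Proof. exact: proj_mul. Qed.

End AnnihilatorQuotient.

Section QuotientGrading.
Variables (G : groupType) (R : comPzRingType) (gR : gradedRing G R).
Variables (M : lmodType R) (gM : gradedModule gR M).
Local Notation pi := (@annihilator_proj R M).

Definition quotient_component (g : G) : set (annihilator_quotient M) :=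
  pi @` gR g.

Lemma annihilator_graded r c : r \in annihilator M -> decomposition gR r c ->
  forall g, c g \in annihilator M.
Proof.
have g0 : graded_submodule gM [set 0].
  split; first by split=> // a x y -> ->; rewrite scaler0 addr0.
  apply/(direct_sum_subP (module_componentP gM)).
    by split=> // x y -> ->; rewrite subr0.
  move=> x c' -> dc g.
  have [_ _ u] := module_componentP gM.
  by rewrite (u _ _ _ dc (decomp0 (module_component_subgroup gM))).
move=> /annihilatorP Hr dc g; apply/annihilatorP.
exact: (gradedI (colon_graded g0) Hr dc g).
Qed.

Lemma quotient_component_subgroup g : additive_subgroup (quotient_component g).
Proof.
have [R0 RB] := ring_component_subgroup gR g.
split=> [|_ _ [r Rr <-] [s Rs <-]]; first by exists 0 => //; rewrite proj0.
by exists (r - s); [exact: RB|rewrite projB].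
Qed.

Lemma decomp_proj r c : decomposition gR r c ->
  decomposition quotient_component (pi r) (pi \o c).
Proof.
move=> dc; have [Rc _ _] := dc.
apply: decomp_morph dc; [exact: proj0|exact: projD|].
by move=> g; exists (c g).
Qed.

Fact quotient_componentP :
  internal_direct_sum quotient_component [set: annihilator_quotient M].
Proof.
apply: direct_sum0 => [|x|d dd g]; first exact: quotient_component_subgroup.
  split=> // _; have [r <-] := projP x.
  by have [c dc] := ring_decomp gR r; exists (pi \o c); apply: decomp_proj.
have Hd h : exists r, [/\ gR h r, pi r = d h & d h = 0 -> r = 0].
  have [Qd _ _] := dd; have [r Rr rd] := Qd h.
  have [d0|/eqP d0] := eqVneq (d h) 0; last by exists r; split=> // /d0.
  exists 0; rewrite proj0; split=> //.
  by have [] := ring_component_subgroup gR h.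
have [c Hc] := choice Hd.
have [_ [s [sc E]]] := (decompP _ _ _).1 dd.
have dc : decomposition gR (\sum_(h <- s) c h) c.
  apply/decompP; split=> [h|]; first by case: (Hc h).
  by exists s; split=> // h /sc dh; case: (Hc h) => _ _; apply.
have [_ <- _] := Hc g; apply/proj_eq0; apply: annihilator_graded dc g.
apply/(@proj_eq0 R M); rewrite (big_morph _ (@projD R M) (@proj0 R M)) [RHS]E.
by apply: eq_bigr => h _; case: (Hc h).
Qed.

Fact quotient_componentM g h x y :
  quotient_component g x -> quotient_component h y ->
  quotient_component (g * h)%g (x * y).
Proof.
move=> [r Rr <-] [s Rs <-]; exists (r * s); last exact: projM.
exact: ring_componentM.
Qed.

Definition quotient_gradedRing : gradedRing G (annihilator_quotient M) :=
  GradedRing quotient_componentP quotient_componentM.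

Lemma proj_prime (p : set R) : (forall r, r \in annihilator M -> p r) ->
  graded_prime_ideal gR p -> graded_prime_ideal quotient_gradedRing (pi @` p).
Proof.
move=> Ap [gp pT pp]; have [ip _] := gp; have [p0 pP] := ip.
have piP r : (pi @` p) (pi r) -> p r.
  move=> [s ps /proj_eq srA]; rewrite -[r](subKr s).
  by apply: (ideal_subgroup ip).2 => //; apply: Ap.
have ipi : ideal (pi @` p).
  split=> [|a _ _ [r pr <-] [s ps <-]]; first by exists 0 => //; rewrite proj0.
  have [b <-] := projP a; exists (b * r + s); first exact: pP.
  by rewrite projD projM.
split.
- split=> //; apply/(direct_sum_subP quotient_componentP).
    exact: ideal_subgroup.
  move=> _ d [r pr <-] dd g; have [c dc] := ring_decomp gR r.
  have [_ _ u] := quotient_componentP.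
  rewrite (u _ _ _ dd (decomp_proj dc)); exists (c g) => //.
  exact: gradedI gp pr dc g.
- move=> E; apply: pT; apply/seteqP; split=> // r _; apply: piP.
  by rewrite E.
- move=> _ _ [g _ [r Rr <-]] [h _ [s Rs <-]] /=.
  rewrite -projM => /piP /pp[||pr|ps]; [by exists g|by exists h|left|right].
    by exists r.
  by exists s.
Qed.

Fact rho_subproof (Q : primary_spectrum gM) :
  pi @` colon (module_radical gM Q) \in Spec_ring quotient_gradedRing.
Proof.
apply/mem_set/proj_prime; last exact: point_prime.
by move=> r /annihilatorP Hr m P [[[[P0 _] _] _ _] _]; rewrite Hr.
Qed.

Definition rho (Q : primary_spectrum gM) : Spec_ring quotient_gradedRing :=
  exist _ (pi @` colon (module_radical gM Q)) (rho_subproof Q).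

End QuotientGrading.
Arguments rho {G R gR M} gM Q.

(* Main.v *)
Require Import Defs.
From HB Require Import structures.
From mathcomp Require Import all_boot all_algebra finmap.
From mathcomp Require Import boolp classical_sets functions cardinality fsbigop.
From mathcomp Require Import topology.

(** A point [Q] lies in [nu gM N] iff the graded prime [(Gr_M(Q) : M)] contains
    [(N : M)], and by surjectivity of [rho] every graded prime containing
    [Ann(M)] arises in this way.  Given an open cover by the complements of the
    [nu gM (N i)], let [J] be the graded ideal generated by [Ann(M)] and all the
    [(N i : M)].  If no positive power of [r] were in [J], Zorn's lemma would
    give a graded prime above [J] avoiding these powers, hence a point outside
    the cover with [r] not in its prime.  So some power of [r] lies in [J], thus
    already in the graded ideal generated by [Ann(M)] and finitely many
    [(N i : M)], and the corresponding opens cover.  The whole space is the case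
    [r = 1]. *)

Set Implicit Arguments.
Unset Strict Implicit.
Unset Printing Implicit Defensive.

Import GRing.Theory.

Local Open Scope classical_set_scope.
Local Open Scope ring_scope.

(** * Graded ideals, and graded primes avoiding the powers of an element *)

Section GradedIdeals.
Variables (G : groupType) (R : comPzRingType) (gR : gradedRing G R).
Implicit Types (I J p X : set R) (a b r x : R).

Lemma graded_idealP I : graded_ideal gR I <-> ideal I /\
  forall x c, I x -> decomposition gR x c -> forall g, I (c g).
Proof.
split=> -[iI H]; split=> //.
  by apply/(direct_sum_subP (ring_componentP gR)) => //; apply: ideal_subgroup.
by apply/(direct_sum_subP (ring_componentP gR)) => //; apply: ideal_subgroup.
Qed.

Lemma graded_ideal_bigcap (F : set (set R)) :
  (forall I, F I -> graded_ideal gR I) -> graded_ideal gR (\bigcap_(I in F) I).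
Proof.
move=> FI; apply/graded_idealP; split; first split.
- by move=> I /FI[[]].
- move=> a x y Fx Fy I FII; have [[_ IP] _] := FI _ FII.
  by apply: IP; [apply: Fx|apply: Fy].
- move=> x c Fx dc g I FII; apply: gradedI dc g; first exact: FI.
  exact: Fx.
Qed.

(** Directedness brings any two elements into one member. Serves both for chains in Zorn's lemma and
    for unions over finite subfamilies. *)
Lemma graded_ideal_directed_bigcup (K : Type) (D : set K) (F : K -> set R) :
  D !=set0 -> (forall k, D k -> graded_ideal gR (F k)) ->
  (forall k l, D k -> D l ->
    exists m, [/\ D m, F k `<=` F m & F l `<=` F m]) ->
  graded_ideal gR (\bigcup_(k in D) F k).
Proof.
move=> [k0 Dk0] FI dirF; apply/graded_idealP; split; first split.
- by exists k0 => //; case: (FI _ Dk0) => -[].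
- move=> a x y [k Dk kx] [l Dl ly]; have [m [Dm km lm]] := dirF k l Dk Dl.
  by exists m => //; have [[_ mP] _] := FI _ Dm; apply: mP; [apply: km|apply: lm].
- by move=> x c [k Dk kx] dc g; exists k => //; apply: gradedI dc g => //; apply: FI.
Qed.

Lemma decomp_mulr g a x c : gR g a -> decomposition gR x c ->
  decomposition gR (x * a) (fun k => c (k * g^-1)%g * a).
Proof.
move=> Ra dc; have [Rc _ _] := dc.
apply: (decomp_reindex (V_ := fun k => gR (k * g)%g) (x := x * a)
  (c := fun k => c k * a) (h := fun k => (k * g^-1)%g) (h' := fun k => (k * g)%g)).
- by move=> k; rewrite mulgVK.
- by move=> k; rewrite mulgK.
- by move=> k; rewrite -[k in gR k](mulgVK g); apply: ring_componentM.
- apply: (decomp_morph (f := fun y => y * a) _ _ _ dc).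
  + by rewrite mul0r.
  + by move=> y z; rewrite mulrDl.
  + by move=> k; apply: ring_componentM.
Qed.

(** The ideal [I + Ra]; the minus sign fits [decompB], which decomposes differences. *)
Definition ideal_adjoin I a : set R := [set x | exists y s, I y /\ x = y - s * a].

Lemma sub_ideal_adjoin I a : I `<=` ideal_adjoin I a.
Proof. by move=> x Ix; exists x, 0; rewrite mul0r subr0. Qed.

Lemma ideal_adjoin_gen I a : ideal I -> ideal_adjoin I a a.
Proof. by move=> [I0 _]; exists 0, (-1); rewrite mulN1r opprK add0r. Qed.

Lemma graded_ideal_adjoin I a : graded_ideal gR I -> homogeneous gR a ->
  graded_ideal gR (ideal_adjoin I a).
Proof.
move=> gI [g _ Ra]; have [[I0 IP] _] := gI.
apply/graded_idealP; split; first split.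
- exact: sub_ideal_adjoin.
- move=> b _ _ [y [s [Iy ->]]] [z [t [Iz ->]]].
  exists (b * y + z), (b * s + t); split; first exact: IP.
  by rewrite mulrBr mulrDl opprD mulrA addrACA.
- move=> _ d [y [s [Iy ->]]] dd k.
  have [[c dc] [e de]] := (ring_decomp gR y, ring_decomp gR s).
  have df := decompB (ring_component_subgroup gR) dc (decomp_mulr Ra de).
  rewrite (ring_decomp_uniq dd df); exists (c k), (e (k * g^-1)%g); split=> //.
  exact: gradedI gI Iy dc k.
Qed.

(** Every term of the expanded product has a factor from [I] or the factor [a * b]. *)
Lemma ideal_adjoinM I a b x y : ideal I -> I (a * b) ->
  ideal_adjoin I a x -> ideal_adjoin I b y -> I (x * y).
Proof.
move=> iI Iab [u [s [Iu ->]]] [v [t [Iv ->]]].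
have sI := ideal_subgroup iI.
rewrite mulrBl [u * _]mulrC [s * a * _]mulrBr.
apply: sI.2; first exact: ideal_mul.
apply: sI.2; first exact: ideal_mul.
by rewrite mulrACA; apply: ideal_mul.
Qed.

(** Take [p] maximal. For homogeneous [a], [b] outside [p], both [p + Ra] and [p + Rb] contain
    powers of [r]; if [a * b] were in [p], so would be the product of these powers. *)
Lemma graded_prime_avoiding J r : graded_ideal gR J ->
  (forall n, ~ J (r ^+ n.+1)) ->
  exists p, [/\ graded_prime_ideal gR p, J `<=` p & forall n, ~ p (r ^+ n.+1)].
Proof.
move=> gJ Jr.
(* Zorn_bigcup also asks for the union of the empty chain, hence [J `|` X]. *)
pose avoiding X := graded_ideal gR (J `|` X) /\
  forall n, ~ (J `|` X) (r ^+ n.+1).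
have chain (F : set (set R)) : F `<=` avoiding -> total_on F subset ->
    avoiding (\bigcup_(X in F) X).
  move=> Fav Ftot.
  have [->|/set0P F0] := eqVneq F set0.
    by rewrite bigcup_set0 /avoiding setU0.
  have JF : J `|` \bigcup_(X in F) X = \bigcup_(X in F) (J `|` X).
    by rewrite bigcupUr.
  rewrite /avoiding JF; split; last first.
    by move=> n [X FX]; case: (Fav X FX) => _ /(_ n).
  apply: graded_ideal_directed_bigcup => // [X /Fav[]//|X Y FX FY].
  have [XY|YX] := Ftot X Y FX FY.
    by exists Y; split=> //; apply: setUS.
  by exists X; split=> //; apply: setUS.
have [A [[gp pr] maxA]] := Zorn_bigcup chain.
exists (J `|` A); set p := J `|` A in gp pr *.
have [ip _] := gp.
have power a : homogeneous gR a -> ~ p a -> exists n, ideal_adjoin p a (r ^+ n.+1).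
  move=> ha npa; apply: contrapT => /forallNP Hn.
  have pB := @sub_ideal_adjoin p a.
  have JB : J `|` ideal_adjoin p a = ideal_adjoin p a.
    by apply: setUidr => x Jx; apply: pB; left.
  (* Maximality concerns [A], not [p]; the larger ideal strictly contains [A] because [a] is outside
     [p]. *)
  apply: (maxA (ideal_adjoin p a)).
    split; first by move=> x Ax; apply: pB; right.
    by move=> /(_ a (ideal_adjoin_gen a ip)) Aa; apply: npa; right.
  by rewrite /avoiding JB; split=> //; apply: graded_ideal_adjoin.
split=> //; [split=> //|by move=> x Jx; left].
- by move=> pT; apply: (pr 0%N); rewrite pT.
- move=> a b ha hb pab; apply: contrapT => /not_orP[npa npb].
  have [[n an] [m bm]] := (power a ha npa, power b hb npb).
  (* [pr] adds one to its argument, so the exponent is [n.+1 + m.+1]. *)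
  apply: (pr (n.+1 + m)%N); rewrite -addnS exprD.
  exact: ideal_adjoinM an bm.
Qed.

Lemma graded_prime_exp p r n : graded_prime_ideal gR p -> homogeneous gR r ->
  p (r ^+ n.+1) -> p r.
Proof.
move=> [_ _ pp] hr; elim: n => [|n IHn]; first by rewrite expr1.
by rewrite exprS => /pp[//||//|]; [apply: homogeneousXS|apply: IHn].
Qed.

End GradedIdeals.

(** * Points of the spectrum as graded primes, and quasi-compactness *)

Section PrimarySpectrum.
Variables (G : groupType) (R : comPzRingType) (gR : gradedRing G R).
Variables (M : lmodType R) (gM : gradedModule gR M).
Implicit Types (p : set R) (r : R) (Q : primary_spectrum gM).

Lemma annihilator_colon (N : set M) r : submodule N ->
  r \in annihilator M -> colon N r.
Proof. by move=> [N0 _] /annihilatorP Hr m; rewrite Hr. Qed.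

Lemma annihilator_point Q r :
  r \in annihilator M -> colon (module_radical gM Q) r.
Proof. by apply: annihilator_colon; case: (module_radical_graded gM Q). Qed.

(** Representatives of one class differ by an element of [Ann(M)], which lies in [J]. *)
Lemma annihilator_proj_sub (I J : set R) : ideal J ->
  (forall r, r \in annihilator M -> J r) ->
  @annihilator_proj R M @` I `<=` @annihilator_proj R M @` J -> I `<=` J.
Proof.
move=> iJ AJ IJ r Ir.
have [|s Js /proj_eq srA] := IJ (annihilator_proj M r); first by exists r.
by rewrite -[r](subKr s); apply: (ideal_subgroup iJ).2 => //; apply: AJ.
Qed.

(** Some [Q] is sent by [rho] to [p/Ann(M)]; the equality of images lifts to [R] since both ideals
    contain [Ann(M)]. *)
Lemma rho_surj_point p :
  set_surj [set: primary_spectrum gM]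
    [set: Spec_ring (quotient_gradedRing gM)] (rho gM) ->
  graded_prime_ideal gR p -> (forall r, r \in annihilator M -> p r) ->
  exists Q, colon (module_radical gM Q) = p.
Proof.
move=> rho_surj pp Ap.
have piS : annihilator_proj M @` p \in Spec_ring (quotient_gradedRing gM).
  exact/mem_set/proj_prime.
have [Q _ /(congr1 val)/= EQ] := rho_surj (SigSub piS) I.
have [[[ip _] _ _] [[iQ _] _ _]] := (pp, point_prime Q).
by exists Q; apply/seteqP; split; apply: annihilator_proj_sub => //;
  rewrite ?EQ //; exact: annihilator_point.
Qed.

Lemma basic_openE r :
  basic_open gM r = [set Q | ~ colon (module_radical gM Q) r].
Proof.
rewrite /basic_open; congr (~` _); apply/seteqP; split=> Q /=.
  by apply=> m; exists m.
by move=> Qr s sr m; have [n _ <-] := sr m; apply: Qr.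
Qed.

(** Stating the condition on [r] through graded primes lets one argument serve homogeneous [r] and
    [r = 1] alike. *)
Lemma cover_compact_avoiding r :
  set_surj [set: primary_spectrum gM]
    [set: Spec_ring (quotient_gradedRing gM)] (rho gM) ->
  (forall p n, graded_prime_ideal gR p -> p (r ^+ n.+1) -> p r) ->
  cover_compact [set Q : primary_spectrum gM | ~ colon (module_radical gM Q) r].
Proof.
move=> rho_surj radr K D f fop fcov.
have /choice[N HN] k : exists N : set M,
    D k -> graded_submodule gM N /\ f k = ~` nu gM N.
  have [Dk|nDk] := pselect (D k); last by exists set0.
  by have /zariski_openP[N HN] := fop _ Dk; exists N.
pose above (E : {fset K}) := [set I : set R | [/\ graded_ideal gR I,
  (forall s, s \in annihilator M -> I s) &
  forall k, k \in E -> colon (N k) `<=` I]].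
pose finD := [set E : {fset K} | {subset E <= D}].
(* The inner intersection is the least graded ideal above [Ann(M)] and the [colon (N k)] with [k] in
   [E]; with the union over finite [E], membership in [J] yields a finite subfamily at once. *)
pose J := \bigcup_(E in finD) \bigcap_(I in above E) I.
have gJ : graded_ideal gR J.
  apply: graded_ideal_directed_bigcup.
  - by exists fset0.
  - by move=> E _; apply: graded_ideal_bigcap => I [].
  - move=> E E' ED ED'; exists (E `|` E')%fset; split.
    + by move=> k; rewrite in_fsetU => /orP[/ED|/ED'].
    + move=> x Hx I [gI AI NI]; apply: Hx; split=> // k kE.
      by apply: NI; rewrite in_fsetU kE.
    + move=> x Hx I [gI AI NI]; apply: Hx; split=> // k kE.
      by apply: NI; rewrite in_fsetU kE orbT.
have [n [E ED En]] : exists n, J (r ^+ n.+1).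
  apply: contrapT => /forallNP Jr.
  have [p [pp Jp pr]] := graded_prime_avoiding gJ Jr.
  have Ap s : s \in annihilator M -> p s.
    by move=> As; apply: Jp; exists fset0 => // I [_ + _]; apply.
  have [Q EQ] := rho_surj_point rho_surj pp Ap.
  have [|k Dk] := fcov Q.
    by rewrite /= EQ -[r]expr1; apply: pr.
  have [_ ->] := HN k Dk; apply; rewrite /nu/= EQ => s Ns.
  apply: Jp; exists [fset k]%fset.
    by move=> l; rewrite in_fset1 => /eqP->; apply: mem_set.
  by move=> I [_ _ NI]; apply: NI Ns; rewrite in_fset1.
exists E => // Q nQr; apply: contrapT => nQf; apply: nQr.
(* As [Q] is outside all [f k] with [k] in [E], its prime belongs to [above E] and so contains the
   power of [r]. *)
apply: (radr _ n (point_prime Q)); apply: En; split.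
- by case: (point_prime Q).
- exact: annihilator_point.
- move=> k kE; apply: contrapT => nNk; apply: nQf; exists k => //.
  by have [_ ->] := HN k (set_mem (ED k kE)).
Qed.

End PrimarySpectrum.

Theorem theorem3p4 (G : groupType) (R : comPzRingType) (gR : gradedRing G R)
    (M : lmodType R) (gM : gradedModule gR M) :
  Spec_module gM !=set0 ->
  [set: primary_spectrum gM] !=set0 ->
  set_surj [set: primary_spectrum gM]
    [set: Spec_ring (quotient_gradedRing gM)] (rho gM) ->
  (forall r : R, homogeneous gR r -> cover_compact (basic_open gM r)) /\
  cover_compact [set: primary_spectrum gM].
Proof.
move=> _ _ rho_surj; split=> [r hr|].
  rewrite basic_openE; apply: cover_compact_avoiding => // p n pp.
  exact: graded_prime_exp hr.
(* The primes of points are proper, so none contains 1. *)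
have -> : [set: primary_spectrum gM] =
    [set Q | ~ colon (module_radical gM Q) 1].
  apply/seteqP; split=> // Q _ /= Q1; have [[iQ _] QT _] := point_prime Q.
  by apply: QT; apply/seteqP; split=> // s _; rewrite -[s]mulr1; exact: (ideal_mul s iQ Q1).
by apply: cover_compact_avoiding => // p n _; rewrite expr1n.
Qed.
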